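(* Let $\mathcal{P}$ be a finite poset containing two incomparable elements $a,b\in\mathcal{P}$ such that $a$ and $b$ are both smaller than every element of $\mathcal{P}\setminus\{a,b\}$. Then for every $n\in\mathbb{N}$, $\mathrm{sat}^{*}(n,\mathcal{P})\geq n+1$.
   Context: For $n\in\mathbb{N}$, $[n]=\{1,\dots,n\}$ and $2^{[n]}$ is the family of all subsets of $[n]$. For posets $\mathcal{P}$ and $\mathcal{Q}$, $\mathcal{Q}$ contains an induced copy of $\mathcal{P}$ if there is an injective map $f:\mathcal{P}\to\mathcal{Q}$ with $f(x)\preceq_{\mathcal{Q}}f(y)$ if and only if $x\preceq_{\mathcal{P}}y$. A family $\mathcal{F}\subseteq 2^{[n]}$ is induced $\mathcal{P}$-saturated if $(\mathcal{F},\subseteq)$ contains no induced copy of $\mathcal{P}$, but for every $F\in 2^{[n]}\setminus\mathcal{F}$ the poset $(\mathcal{F}\cup\{F\},\subseteq)$ contains an induced copy of $\mathcal{P}$. $\mathrm{sat}^{*}(n,\mathcal{P})$ denotes the minimum size of an induced $\mathcal{P}$-saturated family $\mathcal{F}\subseteq 2^{[n]}$. *)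

(* Defs.v *)
From mathcomp Require Import all_boot all_order.

Set Implicit Arguments.
Unset Strict Implicit.
Unset Printing Implicit Defensive.

Import Order.TTheory.

(* Maps [P -> 2^[n]] are taken as finite functions so that the notions below
   are decidable; the ground set [n] is ['I_n]. *)
Definition contains_induced (d : Order.disp_t) (P : finPOrderType d) (n : nat)
    (F : {set {set 'I_n}}) : bool :=
  [exists f : {ffun P -> {set 'I_n}},
     [&& injectiveb f,
         [forall x, f x \in F]
       & [forall x, forall y, (f x \subset f y) == (x <= y)%O]]].

Definition induced_saturated (d : Order.disp_t) (P : finPOrderType d) (n : nat)
    (F : {set {set 'I_n}}) : bool :=
  ~~ contains_induced P F
    && [forall A : {set 'I_n}, (A \notin F) ==> contains_induced P (A |: F)].

(* [set0] is only a default value, giving 0 if there were no saturated family;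
   [sat_starP] shows that it plays no role for nonempty [P]. *)
Definition sat_star (n : nat) (d : Order.disp_t) (P : finPOrderType d) : nat :=
  #|[arg min_(F < (set0 : {set {set 'I_n}}) | induced_saturated P F) #|F| ]|.

Lemma contains_inducedP (d : Order.disp_t) (P : finPOrderType d) (n : nat)
    (F : {set {set 'I_n}}) :
  reflect (exists f : P -> {set 'I_n},
             [/\ injective f, forall x, f x \in F
               & forall x y, f x \subset f y <-> (x <= y)%O])
          (contains_induced P F).
Proof.
apply: (iffP existsP) => [[f /and3P[/injectiveP fI /forallP fF /forallP fE]]|].
  by exists f; split=> // x y; rewrite (eqP (forallP (fE x) y)).
case=> f [fI fF fE]; exists (finfun f); apply/and3P; split.
- by apply/injectiveP => x y; rewrite !ffunE => /fI.
- by apply/forallP => x; rewrite ffunE.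
- apply/forallP => x; apply/forallP => y; rewrite !ffunE.
  by apply/eqP; apply/idP/idP => /fE.
Qed.

Lemma induced_saturated_exists (d : Order.disp_t) (P : finPOrderType d)
    (n : nat) (x0 : P) :
  exists F : {set {set 'I_n}}, induced_saturated P F.
Proof.
pose p (F : {set {set 'I_n}}) := ~~ contains_induced P F.
have p0 : p set0.
  by apply/contains_inducedP => -[f [_ /(_ x0)]]; rewrite inE.
have [F /maxsetP[pF maxF] _] := maxset_exists p0.
exists F; rewrite /induced_saturated -/(p F) pF /=.
apply/forallP => A; apply/implyP => AF; apply: contraT => pA.
by move: AF; rewrite -(maxF _ pA (subsetUr _ _)) setU11.
Qed.

Lemma sat_starP (d : Order.disp_t) (P : finPOrderType d) (n : nat) (x0 : P) :
  (exists2 F : {set {set 'I_n}}, induced_saturated P F & #|F| = sat_star n P)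
  /\ (forall F : {set {set 'I_n}}, induced_saturated P F -> sat_star n P <= #|F|).
Proof.
have [F0 satF0] := induced_saturated_exists n x0.
rewrite /sat_star /arg_min /extremum; case: pickP => [F /andP[satF minF] | none].
  by split=> [|G satG]; [exists F | exact: (implyP (forallP minF G))].
case: (arg_minnP (fun F : {set {set 'I_n}} => #|F|) satF0) => F satF minF.
have /negP[] := none F; rewrite /= satF /=.
by apply/forallP => G; apply/implyP => /minF.
Qed.

(* Main.v *)
(** If [F] is saturated, then for every point [i] there is [B] in [F] with
    [i] not in [B] and [i |: B] in [F]; contracting these [n] directions one
    after the other loses at least one set each time, so [F] has more than [n]
    members.  To find [B], start from [set0], which lies in [F] because [P] has
    no least element, and keep the invariant that the members of [F] below
    [i |: B] form a chain.  If [i |: B] is not in [F], adding it creates a copy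
    of [P].  By the invariant [i |: B] is one of the two legs of this copy; the
    other leg [C] must strictly contain [B], for otherwise [B] could replace
    [i |: B].  Moreover [C] satisfies the invariant, since two incomparable
    members of [F] below [i |: C] could replace both legs. *)

Require Import Defs.
From mathcomp Require Import all_boot all_order.

Set Implicit Arguments.
Unset Strict Implicit.
Unset Printing Implicit Defensive.

Import Order.TTheory.

Lemma card_gt_directions (T : finType) (S : {set T}) (F : {set {set T}}) :
  F != set0 ->
  (forall i, i \in S -> exists B, [/\ B \in F, i \notin B & i |: B \in F]) ->
  #|S| < #|F|.
Proof.
have [m] := ubnP #|S|; elim: m => // m IHm in S F *; rewrite ltnS => leSm F0 dirF.
have [->|[i iS]] := set_0Vmem S; first by rewrite cards0 card_gt0.
have [B [BF iB iBF]] := dirF i iS.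
(* Deleting [i] sends [B] and [i |: B] to the same set, so dropping [B] first does not change the
   image of [F]; this saves the one member that the induction needs. *)
pose G := [set A :\ i | A in F :\ B].
have GF A : A \in F -> A :\ i \in G.
  move=> AF; have [->|AB] := eqVneq A B.
    have -> : B :\ i = (i |: B) :\ i.
      by apply/setP=> x; rewrite !inE; case: eqP.
    apply: imset_f; rewrite !inE iBF andbT.
    by apply: contraNneq iB => <-; rewrite setU11.
  by apply: imset_f; rewrite !inE AB.
rewrite (cardsD1 i) iS (cardsD1 B F) BF ltnS.
apply: leq_trans (leq_imset_card (fun A => A :\ i) (F :\ B)).
apply: IHm; first by move: leSm; rewrite (cardsD1 i) iS.
  by apply/set0Pn; exists (B :\ i); apply: GF.
(* The other directions survive: for [j != i], deleting [i] commutes with adding [j]. *)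
move=> j; rewrite !inE => /andP[ji jS]; have [A [AF jA jAF]] := dirF j jS.
exists (A :\ i); split; first exact: GF.
  by rewrite !inE (negPf jA) andbF.
have -> : j |: A :\ i = (j |: A) :\ i; last exact: GF.
by apply/setP=> x; rewrite !inE; case: (eqVneq x j) => // ->; rewrite ji.
Qed.

Definition legs (d : Order.disp_t) (P : finPOrderType d) (a b : P) :=
  (a >< b)%O /\
  forall x : P, x != a -> x != b -> (a < x)%O /\ (b < x)%O.

Lemma legs_sym (d : Order.disp_t) (P : finPOrderType d) (a b : P) :
  legs a b -> legs b a.
Proof.
case=> ab low; split; first by rewrite comparable_sym.
by move=> x xb xa; case: (low x xa xb).
Qed.

(** The exchange behind the contradictions below: the legs of a copy matter only through being
    incomparable and lying below all other points. The old legs [f a] and [f b] need not belong to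
    [F]. *)
Lemma contains_induced_legs (d : Order.disp_t) (P : finPOrderType d) (a b : P)
    (n : nat) (F : {set {set 'I_n}}) (f : P -> {set 'I_n}) (A C : {set 'I_n}) :
  legs a b ->
  (forall x y, f x \subset f y <-> (x <= y)%O) ->
  (forall x, x != a -> x != b ->
     [/\ f x \in F, A \subset f x & C \subset f x]) ->
  A \in F -> C \in F -> ~~ (A \subset C) -> ~~ (C \subset A) ->
  contains_induced P F.
Proof.
move=> [ab low] fE top AF CF nAC nCA.
have /norP[/negPf nab /negPf nba] : ~~ ((a <= b)%O || (b <= a)%O) := ab.
pose g x := if x == a then A else if x == b then C else f x.
have gE x y : g x \subset g y <-> (x <= y)%O.
  rewrite /g; have [->|xa] := eqVneq x a.
    have [->|ya] := eqVneq y a; first by rewrite subxx lexx.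
    have [->|yb] := eqVneq y b; first by rewrite (negPf nAC) nab.
    by have [_ -> _] := top y ya yb; have [/ltW-> _] := low y ya yb.
  have [->|xb] := eqVneq x b.
    have [->|ya] := eqVneq y a; first by rewrite (negPf nCA) nba.
    have [->|yb] := eqVneq y b; first by rewrite subxx lexx.
    by have [_ _ ->] := top y ya yb; have [_ /ltW->] := low y ya yb.
  have [_ Ax Cx] := top x xa xb; have [ax bx] := low x xa xb.
  have [->|ya] := eqVneq y a.
    by rewrite lt_geF //; split=> // /(subset_trans Cx); rewrite (negPf nCA).
  have [->|yb] := eqVneq y b; last exact: fE.
  by rewrite lt_geF //; split=> // /(subset_trans Ax); rewrite (negPf nAC).
apply/contains_inducedP; exists g; split=> // [x y gxy | x].
  by apply/le_anti/andP; split; apply/gE; rewrite gxy.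
rewrite /g; have [//|xa] := eqVneq x a; have [//|xb] := eqVneq x b.
by have [] := top x xa xb.
Qed.

(** A copy avoiding [A] would already lie in [F], and by injectivity only one point is sent to
    [A]. *)
Lemma saturated_copy (d : Order.disp_t) (P : finPOrderType d) (n : nat)
    (F : {set {set 'I_n}}) (A : {set 'I_n}) :
  induced_saturated P F -> A \notin F ->
  exists f : P -> {set 'I_n}, exists x0 : P,
    [/\ forall x y, f x \subset f y <-> (x <= y)%O, f x0 = A
      & forall x, x != x0 -> f x \in F].
Proof.
move=> /andP[freeF /forallP satF] AF.
have /contains_inducedP[f [fI fF fE]] := implyP (satF A) AF.
have [x0 /eqP fx0|noA] := pickP (fun x => f x == A).
  exists f, x0; split=> // x xx0; have := fF x; rewrite in_setU1 -fx0.
  by rewrite (inj_eq fI) (negPf xx0).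
case/negP: freeF; apply/contains_inducedP; exists f; split=> // x.
by have := fF x; rewrite in_setU1 noA.
Qed.

(** A point sent to [set0] would be a least element of [P], hence below both incomparable legs. *)
Lemma saturated_set0 (d : Order.disp_t) (P : finPOrderType d) (a b : P)
    (n : nat) (F : {set {set 'I_n}}) :
  legs a b -> induced_saturated P F -> set0 \in F.
Proof.
move=> [ab low] satF; apply: contraT => /(saturated_copy satF)[f [x [fE fx _]]].
have minx y : (x <= y)%O by apply/fE; rewrite fx sub0set.
have [xa|xa] := eqVneq x a; first by move: ab; rewrite /Order.comparable -xa minx.
have [xb|xb] := eqVneq x b.
  by move: ab; rewrite /Order.comparable -xb minx orbT.
by have [/lt_geF] := low x xa xb; rewrite minx.
Qed.

Definition chain_below (T : finType) (F : {set {set T}}) (U : {set T}) :=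
  forall A C, A \in F -> C \in F -> A \subset U -> C \subset U ->
  (A \subset C) || (C \subset A).

(** One step of the climb: the other leg [f b] takes over the role of [B]. *)
Lemma chain_below_leg (d : Order.disp_t) (P : finPOrderType d) (a b : P)
    (n : nat) (F : {set {set 'I_n}}) (f : P -> {set 'I_n}) (i : 'I_n)
    (B : {set 'I_n}) :
  legs a b -> ~~ contains_induced P F ->
  (forall x y, f x \subset f y <-> (x <= y)%O) ->
  f a = i |: B -> (forall x, x != a -> f x \in F) -> B \in F ->
  [/\ f b \in F, i \notin f b, B \proper f b & chain_below F (i |: f b)].
Proof.
move=> L freeF fE fa fF BF; have [ab low] := L.
have /norP[nab nba] : ~~ ((a <= b)%O || (b <= a)%O) := ab.
have bF : f b \in F by apply: fF; apply: contraNneq nab => ->.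
have top x : x != a -> x != b -> (i |: B \subset f x) && (f b \subset f x).
  move=> xa xb; have [/ltW/fE ax /ltW/fE bx] := low x xa xb.
  by rewrite -fa ax bx.
have fab : ~~ (f a \subset f b) by apply/negP => /fE; apply/negP.
have fba : ~~ (f b \subset f a) by apply/negP => /fE; apply/negP.
(* Otherwise [B] and [f b] are incomparable, since [f b] is not even inside [i |: B], and they serve
   as legs within [F]. *)
have Bb : B \subset f b.
  apply: contraT => nBb; case/negP: freeF.
  apply: (contains_induced_legs L fE _ BF bF nBb) => [x xa xb|].
    have /andP[] := top x xa xb; rewrite subUset => /andP[_ Bx] bx.
    by split=> //; apply: fF.
  by apply: contra fba => /subset_trans; apply; rewrite fa subsetUr.
split=> //.
- by apply: contra fab => ib; rewrite fa subUset sub1set ib.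
- rewrite properE Bb; apply: contra fba => /subset_trans; apply.
  by rewrite fa subsetUr.
(* Each image of a non-leg contains both [i] and [f b], hence everything below [i |: f b]. *)
move=> A C AF CF Ab Cb; apply: contraT => /norP[nAC nCA]; case/negP: freeF.
apply: (contains_induced_legs L fE _ AF CF nAC nCA) => x xa xb.
have /andP[] := top x xa xb; rewrite subUset => /andP[ix _] bx.
have ibx : i |: f b \subset f x by rewrite subUset ix.
by split; [exact: fF | exact: subset_trans ibx..].
Qed.

Lemma saturated_direction (d : Order.disp_t) (P : finPOrderType d) (a b : P)
    (n : nat) (F : {set {set 'I_n}}) (i : 'I_n) :
  legs a b -> induced_saturated P F ->
  exists B, [/\ B \in F, i \notin B & i |: B \in F].
Proof.
move=> L satF; have freeF : ~~ contains_induced P F by case/andP: satF.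
(* The climb ends because [B] grows strictly inside a ground set of size [n]; [m] bounds the room
   left. *)
suff climb m (B : {set 'I_n}) : n - #|B| < m -> B \in F -> i \notin B ->
    chain_below F (i |: B) -> exists B, [/\ B \in F, i \notin B & i |: B \in F].
  apply: (climb n.+1 set0); rewrite ?inE ?ltnS ?leq_subr //.
    exact: saturated_set0 L satF.
  (* Only [set0] and the singleton of [i] lie below [i |: set0]. *)
  move=> A C _ _; rewrite setU0 !subset1 => /orP[] /eqP-> /orP[] /eqP->;
    by rewrite ?subxx ?sub0set ?orbT.
elim: m B => // m IHm B leBm BF iB chB.
have [iBF|iBF] := boolP (i |: B \in F); first by exists B.
have [f [x [fE fx fF]]] := saturated_copy satF iBF.
have next C : [/\ C \in F, i \notin C, B \proper C & chain_below F (i |: C)] ->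
    exists B, [/\ B \in F, i \notin B & i |: B \in F].
  case=> CF iC /proper_card ltBC; apply: IHm => //.
  have := max_card (mem C); rewrite card_ord => leCn.
  by rewrite -ltnS; apply: leq_trans leBm; rewrite ltnS ltn_sub2l // (leq_trans ltBC).
have [xa|xa] := eqVneq x a.
  rewrite {x}xa in fx fF; exact: next (chain_below_leg L freeF fE fx fF BF).
have [xb|xb] := eqVneq x b.
  rewrite {x xa}xb in fx fF.
  exact: next (chain_below_leg (legs_sym L) freeF fE fx fF BF).
(* If [i |: B] is not a leg, both legs are members of [F] below it, and the invariant makes them
   comparable. *)
have [ab low] := L; have [/ltW/fE ax /ltW/fE bx] := low x xa xb.
rewrite fx in ax bx.
have aF : f a \in F by apply: fF; rewrite eq_sym.
have bF : f b \in F by apply: fF; rewrite eq_sym.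
by case/negP: ab; have /orP[/fE|/fE] := chB _ _ aF bF ax bx;
  rewrite /Order.comparable => ->; rewrite ?orbT.
Qed.

Theorem theorem3 (d : Order.disp_t) (P : finPOrderType d) (a b : P)
    (incomp_ab : (a >< b)%O)
    (below : forall x : P, x != a -> x != b -> (a < x)%O /\ (b < x)%O)
    (n : nat) :
  n + 1 <= sat_star n P.
Proof.
have L : legs a b by [].
have [[F satF <-] _] := sat_starP n a.
rewrite addn1 -[X in X < _]card_ord -cardsT; apply: card_gt_directions.
  by apply/set0Pn; exists set0; apply: saturated_set0 L satF.
by move=> i _; apply: saturated_direction L satF.
Qed.
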